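(* Let $X$ be a pointed metric space and $E$ a Banach space over $\mathbb{K}$. The map $K\colon X^\#\circledast E^*\to\mathrm{Lip}_{0F}(X,E^* )$, defined by $$K\left(\sum_{j=1}^m g_j\boxtimes\phi_j\right)=\sum_{j=1}^m g_j\cdot\phi_j ,$$ is a (well-defined) linear isomorphism.
   Context: $\mathbb{K}$ is $\mathbb{R}$ or $\mathbb{C}$. A pointed metric space $X$ is a metric space with a distinguished base point $0$. For a pointed metric space $X$ and a Banach space $F$, $\mathrm{Lip}_0(X,F)$ is the vector space of all Lipschitz maps $f\colon X\to F$ with $f(0)=0$, and $X^\#=\mathrm{Lip}_0(X,\mathbb{K})$. $E^*$ is the topological dual of $E$ and $\langle\phi,e\rangle=\phi(e)$; $V'$ denotes the algebraic dual of a vector space $V$. For $x,y\in X$ and $e\in E$, $\delta_{(x,y)}\boxtimes e\in \mathrm{Lip}_0(X,E^* )'$ is the linear functional $f\mapsto\langle f(x)-f(y),e\rangle$. The Lipschitz tensor product $X\boxtimes E$ is the linear subspace of $\mathrm{Lip}_0(X,E^* )'$ spanned by all the functionals $\delta_{(x,y)}\boxtimes e$ with $x,y\in X$, $e\in E$. Every $u\in X\boxtimes E$ can be written (non-uniquely) as $u=\sum_{i=1}^n\delta_{(x_i,y_i)}\boxtimes e_i$. For $g\in X^\#$ and $\phi\in E^*$, $g\boxtimes\phi\in(X\boxtimes E)'$ is the (well-defined) linear functional $(g\boxtimes\phi)\left(\sum_{i=1}^n \delta_{(x_i,y_i)}\boxtimes e_i\right)=\sum_{i=1}^n(g(x_i)-g(y_i))\langle\phi,e_i\rangle$.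 The space $X^\#\circledast E^*$ (associated Lipschitz tensor product) is the linear subspace of $(X\boxtimes E)'$ spanned by $\{g\boxtimes\phi\colon g\in X^\#,\ \phi\in E^*\}$; every element of it can be written as $\sum_{j=1}^m g_j\boxtimes\phi_j$. For $g\in X^\#$, $\phi\in E^*$, $g\cdot\phi\colon X\to E^*$ is the map $(g\cdot\phi)(x)=g(x)\phi$, which belongs to $\mathrm{Lip}_0(X,E^* )$. $\mathrm{Lip}_{0F}(X,E^* )$ is the linear subspace of those $f\in\mathrm{Lip}_0(X,E^* )$ for which the linear span of $f(X)$ is finite-dimensional (Lipschitz finite-rank operators). *)

(* Defs.v *)
From HB Require Import structures.
From mathcomp Require Import all_boot all_order all_algebra.
From mathcomp Require Import complex.
From mathcomp Require Import all_classical all_reals all_analysis.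

Set Implicit Arguments.
Unset Strict Implicit.
Unset Printing Implicit Defensive.

Import Order.TTheory GRing.Theory Num.Theory.
Import numFieldNormedType.Exports.

Local Open Scope classical_set_scope.
Local Open Scope ring_scope.

(* Over the complex scalars, the norm of a normed module in MathComp-Analysis
   takes its values in R[i]; [of_real] embeds the reals in the scalars, so that
   such norms can be compared with real quantities. *)
Variant scalar_kind := RealScalars | ComplexScalars.

Definition scalars (R : realType) (k : scalar_kind) : numFieldType :=
  match k with RealScalars => R | ComplexScalars => R[i] end.

Definition of_real (R : realType) (k : scalar_kind) :
    {rmorphism R -> scalars R k} :=
  match k with
  | RealScalars => idfun
  | ComplexScalars => real_complex R
  end.

Section OfReal.
Variables (R : realType) (k : scalar_kind).
Local Notation K := (scalars R k).

Lemma ler_of_real (a b : R) : (of_real R k a <= of_real R k b) = (a <= b).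
Proof. by case: k => //=; exact: lecR. Qed.

Lemma ge0_of_real (z : K) : 0 <= z -> exists2 r : R, 0 <= r & of_real R k r = z.
Proof.
case: k z => /= z z0; first by exists z.
move: z0; rewrite lecE => /andP[/eqP/= Imz Rez].
by exists (complex.Re z) => //; case: z Imz {Rez} => a b /= ->.
Qed.

Lemma norm_of_real (a : R) : `|of_real R k a| = of_real R k `|a|.
Proof.
have [a0|/ltW a0] := leP 0 a.
  by rewrite !ger0_norm// -[0](raddf0 (of_real R k)) ler_of_real.
by rewrite !ler0_norm ?raddfN// -[0](raddf0 (of_real R k)) ler_of_real.
Qed.

End OfReal.

Section Span.
Variables (K : fieldType) (V : lmodType K).
Implicit Types S T : set V.

Definition span S : {pred V} := [pred v | `[< exists n (a : 'I_n -> K)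
  (s : 'I_n -> V), (forall i, S (s i)) /\ v = \sum_i a i *: s i >]].

Lemma span_submod_closed S : submod_closed (span S).
Proof.
split; first by apply/asboolP; exists 0%N, (fun=> 0), (fun=> 0); split=> [[]|];
  rewrite ?big_ord0.
move=> c _ _ /asboolP[n [a [s [Ss ->]]]] /asboolP[m [b [t [Tt ->]]]].
apply/asboolP; exists (n + m)%N,
  (fun i : 'I_(n + m) => match fintype.split i with inl j => c * a j | inr j => b j end),
  (fun i : 'I_(n + m) => match fintype.split i with inl j => s j | inr j => t j end).
split=> [i|]; first by case: fintype.splitP.
rewrite big_split_ord scaler_sumr; congr (_ + _); apply: eq_bigr => i _.
  by rewrite scalerA; case: fintype.splitP => [j /= /val_inj<-//|j /= ij];
    have := ltn_ord i; rewrite ij ltnNge leq_addr.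
case: fintype.splitP => [j /= ij|j /= /addnI/val_inj<-//].
by have := ltn_ord j; rewrite -ij ltnNge leq_addr.
Qed.

HB.instance Definition _ S :=
  GRing.isSubmodClosed.Build K V (span S) (span_submod_closed S).

Lemma mem_span S v : S v -> v \in span S.
Proof.
move=> Sv; apply/asboolP; exists 1%N, (fun=> 1), (fun=> v); split=> //.
by rewrite big_ord1 scale1r.
Qed.

Lemma span_sub S (A : {pred V}) : submod_closed A ->
  (forall v, S v -> v \in A) -> {subset span S <= A}.
Proof.
move=> [A0 Acl] SA _ /asboolP[n [a [s [Ss ->]]]].
elim/big_ind: _ => // [u v uA vA|i _].
  by rewrite -[u]scale1r; exact: Acl.
by rewrite -[_ *: _]addr0; apply: Acl => //; exact/SA/Ss.
Qed.

Record span_type S := SpanType { span_val : V ; _ : span_val \in span S }.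

HB.instance Definition _ S := [isSub for @span_val S].
HB.instance Definition _ S := [Choice of span_type S by <:].
HB.instance Definition _ S := [SubChoice_isSubLmodule of span_type S by <:].

Definition span_gen S v (Sv : S v) : span_type S := SpanType (mem_span Sv).

(* meant for linear subspaces A *)
Definition fin_dim (A : {pred V}) : Prop :=
  exists n (b : 'I_n -> V), A =i span (range b).

Lemma fin_dim_sub (A : {pred V}) n (b : 'I_n -> V) : submod_closed A ->
  {subset A <= span (range b)} -> fin_dim A.
Proof.
move=> [A0 Acl] Ab.
pose comb (r : 'rV[K]_n) : V := \sum_i r 0 i *: b i.
have combD c r s : comb (c *: r + s) = c *: comb r + comb s.
  rewrite /comb scaler_sumr -big_split; apply: eq_bigr => i _ /=.
  by rewrite !mxE scalerDl scalerA.
have comb0 : comb 0 = 0 by rewrite /comb big1// => i _; rewrite mxE scale0r.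
have combS p (c : 'I_p -> K) (F : 'I_p -> 'rV_n) :
    comb (\sum_i c i *: F i) = \sum_i c i *: comb (F i).
  rewrite (big_morph comb (id1 := 0) (op1 := +%R))// => [|r s].
    by apply: eq_bigr => i _; rewrite -[_ *: F _]addr0 combD comb0 addr0.
  by rewrite -[r in LHS]scale1r combD scale1r.
have bcomb v : v \in span (range b) -> exists r, v = comb r.
  move=> /asboolP[m [a [s [/(_ _)/cid2-/all_sig2[f _ fs] ->]]]].
  exists (\sum_i a i *: delta_mx 0 (f i)).
  rewrite combS; apply: eq_bigr => i _.
  congr (_ *: _); rewrite /comb (bigD1 (f i))//= mxE !eqxx scale1r big1 ?addr0 ?fs//.
  by move=> j /negPf jf; rewrite mxE eqxx/= jf scale0r.
pose P (d : nat) := `[< exists m (M : 'M[K]_(m, n)),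
  (forall i, comb (row i M) \in A) /\ \rank M = d >].
have P0 : exists d, P d.
  by exists 0%N; apply/asboolP; exists 0%N, 0; split=> [[]//|]; rewrite mxrank0.
have Pn d : P d -> (d <= n)%N.
  by move=> /asboolP[m [M [_ <-]]]; exact: rank_leq_col.
case: (ex_maxnP P0 Pn) => d /asboolP[m [M [MA Md]]] dmax.
exists m, (fun i => comb (row i M)) => v; apply/idP/idP; last first.
  by apply: span_sub => // _ [i _ <-]; exact: MA.
move=> vA; have [r vr] := bcomb _ (Ab _ vA).
have : (r <= M)%MS.
  have PM : P (\rank (col_mx M r)).
    apply/asboolP; exists (m + 1)%N, (col_mx M r); split=> // i.
    case: (split_ordP i) => j ->; first by rewrite rowKu.
    by rewrite rowKd (ord1 j) row_id -vr.
  have := dmax _ PM; rewrite -Md -addsmxE => le.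
  have : (M == M + r)%MS.
    by rewrite -(mxrank_leqif_eq (addsmxSl M r)).2 eqn_leq le andbT mxrankS ?addsmxSl.
  by move=> /andP[_]; apply: submx_trans; exact: addsmxSr.
move=> /submxP[a ra]; rewrite vr ra mulmx_sum_row combS.
apply/asboolP; exists m, (fun i => a 0 i), (fun i => comb (row i M)).
by split=> // i; exists i.
Qed.

End Span.

Section AlgDual.
Variables (K : fieldType) (V : lmodType K).

Definition algdual_pred : {pred V -> K^o} := [pred f | `[< linear f >]].

Lemma algdual_submod_closed : submod_closed algdual_pred.
Proof.
split; first by apply/asboolP => c u v; rewrite scaler0 addr0.
move=> a f g /asboolP lf /asboolP lg; apply/asboolP => c u v.
rewrite !fctE lf lg !scalerDr !scalerA mulrC -!addrA; congr (_ + _).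
by rewrite addrCA.
Qed.

HB.instance Definition _ :=
  GRing.isSubmodClosed.Build K (V -> K^o) algdual_pred algdual_submod_closed.

Record algdual := AlgDual {
  algdual_fun :> V -> K^o ; _ : algdual_fun \in algdual_pred }.

HB.instance Definition _ := [isSub for algdual_fun].
HB.instance Definition _ := [Choice of algdual by <:].
HB.instance Definition _ := [SubChoice_isSubLmodule of algdual by <:].

Lemma algdual_linear (f : algdual) : linear f.
Proof. exact: (asboolW (valP f)). Qed.

HB.instance Definition _ (f : algdual) :=
  GRing.isLinear.Build K V K^o _ f (algdual_linear f).

Definition mk_algdual (f : V -> K^o) (lf : linear f) : algdual :=
  AlgDual (asboolT lf : f \in algdual_pred).

Lemma algdualDE (f g : algdual) v : (f + g) v = f v + g v.
Proof. by []. Qed.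

Lemma algdualZE c (f : algdual) v : (c *: f) v = c *: f v.
Proof. by []. Qed.

End AlgDual.

Section Dual.
Variables (R : realType) (k : scalar_kind).
Local Notation K := (scalars R k).
Variable E : normedModType K.

Definition dual_pred : {pred E -> K^o} :=
  [pred f | `[< linear f /\ continuous f >]].

Lemma dual_submod_closed : submod_closed dual_pred.
Proof.
split.
  apply/asboolP; split; first by move=> c u v; rewrite scaler0 addr0.
  by move=> x; exact: cvg_cst.
move=> a f g /asboolP[lf cf] /asboolP[lg cg]; apply/asboolP; split.
  have /asboolP fP : `[< linear f >] by apply/asboolP.
  move=> c u v; rewrite !fctE lf lg !scalerDr !scalerA mulrC -!addrA.
  by congr (_ + _); rewrite addrCA.
move=> x; apply: cvgD; last exact: cg.
by apply: cvgZr; exact: cf.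
Qed.

HB.instance Definition _ :=
  GRing.isSubmodClosed.Build K (E -> K^o) dual_pred dual_submod_closed.

Record dual := Dual { dual_fun :> E -> K^o ; _ : dual_fun \in dual_pred }.

HB.instance Definition _ := [isSub for dual_fun].
HB.instance Definition _ := [Choice of dual by <:].
HB.instance Definition _ := [SubChoice_isSubLmodule of dual by <:].

Lemma dual_linear (f : dual) : linear f.
Proof. exact: (asboolW (valP f)).1. Qed.

HB.instance Definition _ (f : dual) :=
  GRing.isLinear.Build K E K^o _ f (dual_linear f).

Lemma dual_continuous (f : dual) : continuous f.
Proof. exact: (asboolW (valP f)).2. Qed.

Implicit Types (f g h : dual) (e : E).

Lemma dualDE f g e : (f + g) e = f e + g e.
Proof. by []. Qed.

Lemma dualBE f g e : (f - g) e = f e - g e.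
Proof. by []. Qed.

Lemma dualZE c f e : (c *: f) e = c *: f e.
Proof. by []. Qed.

Definition opnorm (f : dual) : R :=
  sup [set r | exists2 e : E, `|e| <= 1 & of_real R k r = `|f e| ].

Lemma has_sup_opnorm (f : dual) :
  has_sup [set r | exists2 e : E, `|e| <= 1 & of_real R k r = `|f e| ].
Proof.
split; first by exists 0, 0; rewrite ?normr0 ?ler01// linear0 normr0 raddf0.
have /linear_bounded_continuous/linear_boundedP/pinfty_ex_gt0[M M0 fM] :=
  @dual_continuous f.
have [m m0 mM] := ge0_of_real (ltW M0).
exists m => r [e e1 re]; rewrite -(ler_of_real k) re mM.
by apply: le_trans (fM e) _; rewrite ler_piMr ?(ltW M0).
Qed.

Lemma opnorm_ge0 f : 0 <= opnorm f.
Proof.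
apply: sup_upper_bound; first exact: has_sup_opnorm.
by exists 0; rewrite ?normr0 ?ler01// linear0 normr0 raddf0.
Qed.

Lemma ler_opnorm f e : `|f e| <= of_real R k (opnorm f) * `|e|.
Proof.
have [->|e0] := eqVneq e 0; first by rewrite linear0 !normr0 mulr0.
have ne0 : 0 < `|e| by rewrite normr_gt0.
have [r r0 re] := ge0_of_real (normr_ge0 (f (`|e|^-1 *: e))).
have : r <= opnorm f.
  apply: sup_upper_bound; first exact: has_sup_opnorm.
  by exists (`|e|^-1 *: e) => //; rewrite normrZ normfV normr_id mulVf ?gt_eqF.
rewrite -(ler_of_real k) re linearZ/= normrM normfV normr_id.
by rewrite ler_pdivrMl// mulrC.
Qed.

Lemma opnorm_le f (c : R) : 0 <= c ->
  (forall e, `|f e| <= of_real R k c * `|e|) -> opnorm f <= c.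
Proof.
move=> c0 fc; apply: ge_sup; first exact: (has_sup_opnorm f).1.
move=> r [e e1 re]; rewrite -(ler_of_real k) re.
apply: le_trans (fc e) _; rewrite ler_piMr//.
by rewrite -[0](raddf0 (of_real R k)) ler_of_real.
Qed.

Let dual_norm (f : dual) : K := of_real R k (opnorm f).

Let dual_normD f g : dual_norm (f + g) <= dual_norm f + dual_norm g.
Proof.
rewrite /dual_norm -raddfD ler_of_real.
apply: opnorm_le => [|e]; first by rewrite addr_ge0 ?opnorm_ge0.
by rewrite dualDE (le_trans (ler_normD _ _))// raddfD mulrDl lerD ?ler_opnorm.
Qed.

Let dual_normZ (l : K) f : dual_norm (l *: f) = `|l| * dual_norm f.
Proof.
have [c c0 cl] := ge0_of_real (normr_ge0 l).
rewrite /dual_norm -cl -rmorphM; congr (of_real R k _).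
have le h (d : R) (z : K) : 0 <= d -> of_real R k d = `|z| ->
    opnorm (z *: h) <= d * opnorm h.
  move=> d0 dz; apply: opnorm_le => [|e]; first by rewrite mulr_ge0 ?opnorm_ge0.
  by rewrite dualZE normrM rmorphM dz -mulrA ler_wpM2l ?ler_opnorm.
apply/eqP; rewrite eq_le le//=.
have [l0|l0] := eqVneq l 0.
  have -> : c = 0.
    by apply: (fmorph_inj (of_real R k)); rewrite cl l0 normr0 raddf0.
  by rewrite mul0r opnorm_ge0.
have cp : 0 < c.
  rewrite lt_neqAle c0 andbT; apply/eqP => c00; move: l0.
  by rewrite -normr_eq0 -cl -c00 raddf0 eqxx.
rewrite -ler_pdivlMl// -[X in opnorm X <= _](scalerK l0).
by apply: le; rewrite ?invr_ge0// fmorphV cl normfV.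
Qed.

Let dual_norm_eq0 f : dual_norm f = 0 -> f = 0.
Proof.
rewrite /dual_norm => f0; apply/val_inj/funext => e; apply/eqP.
by rewrite -normr_le0 (le_trans (ler_opnorm f e))// f0 mul0r.
Qed.

HB.instance Definition _ :=
  Lmodule_isNormed.Build K dual dual_normD dual_normZ dual_norm_eq0.

Lemma dual_normE (f : dual) : `|f| = of_real R k (opnorm f).
Proof. by []. Qed.

End Dual.

Section Lip0.
Variables (R : realType) (k : scalar_kind) (X : metricType R) (x0 : X).
Local Notation K := (scalars R k).
Variable F : normedModType K.

Definition lip0_pred : {pred X -> F} := [pred f | `[< f x0 = 0 /\
  exists L : R, forall x y, `|f x - f y| <= of_real R k (L * mdist x y) >]].

Lemma lip0_submod_closed : submod_closed lip0_pred.
Proof.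
split.
  apply/asboolP; split=> //; exists 0 => x y.
  by rewrite subrr normr0 mul0r raddf0.
move=> a f g /asboolP[f0 [L fL]] /asboolP[g0 [M gM]]; apply/asboolP; split.
  by rewrite !fctE f0 g0 scaler0 addr0.
have [c c0 ca] := ge0_of_real (normr_ge0 a).
exists (c * L + M) => x y; rewrite !fctE opprD addrACA -scalerBr.
rewrite (le_trans (ler_normD _ _))// mulrDl (rmorphD (of_real R k)) lerD//.
by rewrite normrZ -mulrA rmorphM ca ler_wpM2l.
Qed.

HB.instance Definition _ :=
  GRing.isSubmodClosed.Build K (X -> F) lip0_pred lip0_submod_closed.

Record lip0 := Lip0 { lip0_fun :> X -> F ; _ : lip0_fun \in lip0_pred }.

HB.instance Definition _ := [isSub for lip0_fun].
HB.instance Definition _ := [Choice of lip0 by <:].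
HB.instance Definition _ := [SubChoice_isSubLmodule of lip0 by <:].

Lemma lip0P (f : lip0) : f x0 = 0 /\
  exists L : R, forall x y, `|f x - f y| <= of_real R k (L * mdist x y).
Proof. exact: (asboolW (valP f)). Qed.

Definition mk_lip0 (f : X -> F) (f0 : f x0 = 0)
    (fL : exists L : R, forall x y, `|f x - f y| <= of_real R k (L * mdist x y)) :
    lip0 :=
  Lip0 (asboolT (conj f0 fL) : f \in lip0_pred).

Definition lip0F_pred : {pred lip0} :=
  [pred f : lip0 | `[< fin_dim (span (range f)) >]].

Lemma lip0F_submod_closed : submod_closed lip0F_pred.
Proof.
split.
  apply/asboolP; apply: (@fin_dim_sub _ _ _ 0%N (fun=> 0)).
    exact: span_submod_closed.
  apply: span_sub; first exact: span_submod_closed.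
  move=> _ [x _ <-]; exact: (span_submod_closed (range (fun=> 0 : F))).1.
move=> c f g /asboolP[n [a fa]] /asboolP[m [b gb]]; apply/asboolP.
pose ab i := match fintype.split i with inl j => a j | inr j => b j end.
have cl := span_submod_closed (range ab).
have subl : {subset span (range a) <= span (range ab)}.
  apply: span_sub => // _ [i _ <-]; apply: mem_span.
  exists (lshift m i) => //; rewrite /ab.
  by have := unsplitK (inl i : 'I_n + 'I_m) => /= ->.
have subr : {subset span (range b) <= span (range ab)}.
  apply: span_sub => // _ [i _ <-]; apply: mem_span.
  exists (rshift n i) => //; rewrite /ab.
  by have := unsplitK (inr i : 'I_n + 'I_m) => /= ->.
apply: (@fin_dim_sub _ _ _ (n + m)%N ab); first exact: span_submod_closed.
apply: span_sub => // _ [x _ <-]; apply: cl.2.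
  by apply: subl; rewrite -fa; apply: mem_span; exists x.
by apply: subr; rewrite -gb; apply: mem_span; exists x.
Qed.

HB.instance Definition _ :=
  GRing.isSubmodClosed.Build K lip0 lip0F_pred lip0F_submod_closed.

Record lip0F := Lip0F { lip0F_val :> lip0 ; _ : lip0F_val \in lip0F_pred }.

HB.instance Definition _ := [isSub for lip0F_val].
HB.instance Definition _ := [Choice of lip0F by <:].
HB.instance Definition _ := [SubChoice_isSubLmodule of lip0F by <:].

End Lip0.

Section Tensor.
Variables (R : realType) (k : scalar_kind) (X : metricType R) (x0 : X).
Local Notation K := (scalars R k).
Variable E : normedModType K.
Local Notation "X ^#" := (lip0 x0 K^o) (at level 2, only parsing).

Lemma delta_box_linear x y (e : E) :
  linear (fun f : lip0 x0 (dual E) => (f x - f y) e : K^o).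
Proof.
move=> a f g; rewrite -[RHS]/((a *: (f x - f y) + (g x - g y)) e).
by congr (dual_fun _ e); rewrite scalerBr opprD addrACA.
Qed.

(* delta_(x,y) [x] e, an element of the algebraic dual of Lip_0(X, E^* ) *)
Definition delta_box x y (e : E) : algdual (lip0 x0 (dual E)) :=
  mk_algdual (delta_box_linear x y e).

Definition delta_boxes : set (algdual (lip0 x0 (dual E))) :=
  [set u | exists x y e, u = delta_box x y e].

Definition tensor := span_type delta_boxes.

Lemma delta_boxesP x y (e : E) : delta_boxes (delta_box x y e).
Proof. by exists x, y, e. Qed.

(* the same functional, as an element of the Lipschitz tensor product X [x] E *)
Definition box x y (e : E) : tensor := span_gen (delta_boxesP x y e).

Lemma tensor_repr (u : tensor) :
  exists s : seq (X * X * E), u = \sum_(t <- s) box t.1.1 t.1.2 t.2.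
Proof.
have [n [a [s [ds us]]]] := asboolW (valP u).
have /choice[t tE] : forall i, exists t : X * X * E,
    s i = delta_box t.1.1 t.1.2 t.2.
  by move=> i; have [x [y [e ->]]] := ds i; exists (x, y, e).
exists [seq ((t i).1, a i *: (t i).2) | i <- enum 'I_n].
apply: val_inj; rewrite us raddf_sum big_map big_enum; apply: eq_bigr => i _.
apply/val_inj/funext => f; rewrite tE /=.
by rewrite [RHS](linearZ_LR (f (t i).1.1 - f (t i).1.2)).
Qed.

Lemma lip0_scale0 (g : X^#) (phi : dual E) : g x0 *: phi = 0.
Proof. by rewrite (lip0P g).1 scale0r. Qed.

Lemma lip0_scale_lip (g : X^#) (phi : dual E) : exists L : R, forall x y,
  `|g x *: phi - g y *: phi| <= of_real R k (L * mdist x y).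
Proof.
have [_ [L gL]] := lip0P g.
exists (opnorm phi * L) => x y; rewrite -scalerBl normrZ dual_normE.
rewrite -mulrA rmorphM mulrC ler_wpM2l//.
by rewrite -dual_normE.
Qed.

(* g . phi *)
Definition lip0_scale (g : X^#) (phi : dual E) : lip0 x0 (dual E) :=
  @mk_lip0 _ _ _ x0 _ (fun x => g x *: phi)
    (lip0_scale0 g phi) (lip0_scale_lip g phi).

(* g [x] phi: the value on u is computed from an arbitrary representation of u as a sum of
   elementary tensors; see [box_dualE] for the independence of that choice *)
Definition box_dual_fun (g : X^#) (phi : dual E) (u : tensor) : K^o :=
  \sum_(t <- sval (cid (tensor_repr u))) (g t.1.1 - g t.1.2) * phi t.2.

Lemma box_dual_funE g phi (s : seq (X * X * E)) :
  box_dual_fun g phi (\sum_(t <- s) box t.1.1 t.1.2 t.2) =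
  \sum_(t <- s) (g t.1.1 - g t.1.2) * phi t.2.
Proof.
have ev r : \sum_(t <- r) (g t.1.1 - g t.1.2) * phi t.2 =
    val (\sum_(t <- r) box t.1.1 t.1.2 t.2) (lip0_scale g phi).
  elim: r => [|t r IH]; first by rewrite !big_nil.
  rewrite !big_cons IH (raddfD (val : tensor -> _)) algdualDE.
  congr (_ + _); transitivity (((g t.1.1 - g t.1.2) *: phi) t.2) => //.
  by rewrite scalerBl.
by rewrite /box_dual_fun ev; case: cid => r /= <-; rewrite ev.
Qed.

Lemma box_dual_linear g phi : linear (box_dual_fun g phi).
Proof.
move=> a u v; have [s us] := tensor_repr u; have [r vr] := tensor_repr v.
have auv : a *: u + v =
    \sum_(t <- [seq (t.1, a *: t.2) | t <- s] ++ r) box t.1.1 t.1.2 t.2.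
  rewrite big_cat big_map us vr scaler_sumr; congr (_ + _).
  apply: eq_bigr => t _; apply/val_inj/val_inj/funext => f /=.
  by rewrite [RHS](linearZ_LR (f t.1.1 - f t.1.2)).
rewrite auv box_dual_funE us vr !box_dual_funE big_cat big_map scaler_sumr.
congr (_ + _); apply: eq_bigr => t _ /=.
by rewrite (linearZ_LR phi) /= mulrCA.
Qed.

Definition box_dual (g : X^#) (phi : dual E) : algdual tensor :=
  mk_algdual (box_dual_linear g phi).

Lemma box_dualE g phi (s : seq (X * X * E)) :
  box_dual g phi (\sum_(t <- s) box t.1.1 t.1.2 t.2) =
  \sum_(t <- s) (g t.1.1 - g t.1.2) * phi t.2.
Proof. exact: box_dual_funE. Qed.

Definition box_duals : set (algdual tensor) :=
  [set h | exists g phi, h = box_dual g phi].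

Definition assoc_tensor := span_type box_duals.

Lemma box_dualsP g phi : box_duals (box_dual g phi).
Proof. by exists g, phi. Qed.

(* [box_dual g phi], as an element of the associated tensor product *)
Definition assoc_box (g : X^#) (phi : dual E) : assoc_tensor :=
  span_gen (box_dualsP g phi).

End Tensor.

(* Main.v *)
From HB Require Import structures.
Require Import Defs.
From mathcomp Require Import all_boot all_order all_algebra.
From mathcomp Require Import all_classical all_reals all_analysis.
Import GRing.Theory Num.Theory Order.TTheory.
Import numFieldNormedType.Exports.
Local Open Scope classical_set_scope.
Local Open Scope ring_scope.

(** The space [Lip_0(X, E^* )] is in duality with [X [x] E] by evaluation,
    [<f, u> := u f], and this gives a linear map [f |-> <f, .>] into the
    algebraic dual of [X [x] E].  It is injective, because
    [<f, delta_(x,0) [x] e> = f(x) e] recovers [f], and it sends [g . phi] to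
    [g [x] phi].  The map [K] of the theorem is the inverse of its restriction
    to finite-rank maps, so that [K] does not depend on the chosen
    representation because the evaluation map is injective.

    It remains to see that the finite-rank maps correspond exactly to the
    functionals spanned by the [g [x] phi], that is, that they are exactly the
    finite sums of maps [g . phi].  Each such product has its range on a line.
    Conversely, on a finite-dimensional space of functionals the identity has
    the form [v |-> \sum_j v(e_j) phi_j] with vectors [e_j] of [E]
    ([dual_reproducing]).  Applied to the span of [f(X)], this gives
    [f = \sum_j g_j . phi_j] with [g_j(x) = f(x) e_j].  Each [g_j] is [f]
    followed by evaluation at a fixed vector, hence Lipschitz with constant
    that of [f] times the norm of [e_j]. *)

Section Evaluation.
Variables (R : realType) (k : scalar_kind) (X : metricType R) (x0 : X).
Local Notation K := (scalars R k).
Variable E : normedModType K.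
Implicit Types (f : lip0 x0 (dual E)) (g : lip0 x0 K^o) (phi : dual E).

Lemma lip0_eval_linear f : linear (fun u : tensor x0 E => val u f : K^o).
Proof.
move=> a u v; exact: (erefl ((a *: val u + val v : algdual _) f)).
Qed.

Definition lip0_eval f : algdual (tensor x0 E) :=
  mk_algdual (lip0_eval_linear f).

Lemma lip0_eval_is_linear : linear lip0_eval.
Proof.
move=> a f g; apply/val_inj/funext => u.
exact: (algdual_linear (val u)).
Qed.

HB.instance Definition _ :=
  GRing.isLinear.Build K (lip0 x0 (dual E)) (algdual (tensor x0 E)) _
    lip0_eval lip0_eval_is_linear.

Lemma lip0_eval_box f x y e : lip0_eval f (box x0 x y e) = (f x - f y) e.
Proof. by []. Qed.

(** The base point has value [0], so the elementary tensors at the pairs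
    [(x, x0)] already read off every value [f x e]. *)
Lemma lip0_eval_inj : injective lip0_eval.
Proof.
move=> f g fg; apply/val_inj/funext => x; apply/val_inj/funext => e.
have : lip0_eval f (box x0 x x0 e) = lip0_eval g (box x0 x x0 e) by rewrite fg.
by rewrite !lip0_eval_box (lip0P f).1 (lip0P g).1 !subr0.
Qed.

Lemma lip0_eval_scale g phi : lip0_eval (lip0_scale g phi) = box_dual g phi.
Proof.
apply/val_inj/funext => u; have [s ->] := tensor_repr u.
rewrite /= -[RHS]/(box_dual g phi _) box_dualE.
rewrite -[LHS]/(lip0_eval (lip0_scale g phi) _) linear_sum.
apply: eq_bigr => t _.
transitivity ((lip0_scale g phi t.1.1 - lip0_scale g phi t.1.2) t.2).
  exact: lip0_eval_box.
by rewrite -[lip0_scale _ _ _ - _]scalerBl.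
Qed.

Lemma lip0_scale_finite_rank g phi :
  lip0_scale g phi \in @lip0F_pred R k X x0 (dual E).
Proof.
apply/asboolP; apply: (@fin_dim_sub _ _ _ 1%N (fun=> phi)).
  exact: span_submod_closed.
apply: span_sub => [|_ [x _ <-]]; first exact: span_submod_closed.
change (g x *: phi \in Defs.span (range (fun _ : 'I_1 => phi))).
by apply/rpredZ/mem_span; exists ord0.
Qed.

(** The identity of a finite-dimensional space of functionals is
    [v |-> \sum_p v(p.2) p.1] for finitely many pairs [p].  Generators are
    added one at a time: if [P] is such an operator for the previous ones and
    the new generator [v0] is not fixed by [P], then [w = v0 - P v0] takes the
    value [1] at some [e], and [v |-> P v + (v - P v)(e) w] fixes [v0] as well.
    It has the same form, since [(v - P v)(e)] is the value of [v] at
    [e - \sum_p p.1(e) p.2]. *)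
Lemma dual_reproducing (vs : seq (dual E)) :
  exists s : seq (dual E * E),
    {in vs, forall v : dual E, v = \sum_(p <- s) v p.2 *: p.1}.
Proof.
elim: vs => [|v0 vs [s sP]]; first by exists [::].
pose P (v : dual E) := \sum_(p <- s) v p.2 *: p.1 : dual E.
have [w0|] := eqVneq (v0 - P v0) 0.
  exists s => v; rewrite inE => /predU1P[->|/sP//].
  by apply/eqP; rewrite -subr_eq0 w0.
set w := v0 - P v0 => w0.
have [e we] : exists e, w e = 1.
  apply: contrapT => no; move/eqP: w0; apply.
  apply/val_inj/funext => e; apply/eqP/negPn/negP => we; apply: no.
  by exists ((w e)^-1 *: e); rewrite linearZ /= -[_ *: _]/(_ * _) mulVf.
have PE v : P v e = \sum_(p <- s) v p.2 * p.1 e.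
  by rewrite /P; elim/big_rec2: _ => // p a b _ <-.
exists ((w, e - \sum_(p <- s) p.1 e *: p.2) :: s) => v vvs.
rewrite big_cons -/(P v).
have -> : v (e - \sum_(p <- s) p.1 e *: p.2) = (v - P v) e.
  rewrite linearB linear_sum dualBE PE; congr (_ - _).
  by apply: eq_bigr => p _; rewrite (linearZ_LR v) mulrC.
move: vvs; rewrite inE => /predU1P[->|/sP vP].
  by rewrite -/w we scale1r subrK.
by rewrite [P v]/P -vP subrr scale0r add0r.
Qed.

Lemma lip0_apply0 f e : (f x0) e = 0.
Proof. by rewrite (lip0P f).1. Qed.

Lemma lip0_apply_lip f e : exists L : R, forall x y,
  `|f x e - f y e : K^o| <= of_real R k (L * mdist x y).
Proof.
have [_ [L fL]] := lip0P f; have [c c0 ce] := ge0_of_real (normr_ge0 e).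
exists (L * c) => x y; rewrite -dualBE.
rewrite (le_trans (ler_opnorm _ _))// -dual_normE -ce mulrAC rmorphM.
by rewrite ler_wpM2r // ce.
Qed.

Definition lip0_apply f e : lip0 x0 K^o :=
  mk_lip0 (lip0_apply0 f e) (lip0_apply_lip f e).

(** A reproducing formula on a generating family of the span of the range of
    [f] holds at every [f x] by linearity; its coefficients, as functions of
    [x], are the maps [lip0_apply f p.2]. *)
Lemma finite_rank_sum f : f \in @lip0F_pred R k X x0 (dual E) ->
  exists s : seq (dual E * E),
    f = \sum_(p <- s) lip0_scale (lip0_apply f p.2) p.1.
Proof.
move=> /asboolP[n [b fb]].
have [s sP] := dual_reproducing [seq b i | i <- enum 'I_n].
exists s; apply/val_inj/funext => x; rewrite raddf_sum fct_sumE /=.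
have : f x \in Defs.span (range b) by rewrite -fb; apply: mem_span; exists x.
move=> /asboolP[m [a [t [tb ->]]]].
have tP i : t i = \sum_(p <- s) t i p.2 *: p.1.
  by have [j _ <-] := tb i; apply/sP/map_f; rewrite mem_enum.
rewrite [LHS](eq_bigr (fun i => \sum_(p <- s) (a i *: t i) p.2 *: p.1)).
  rewrite exchange_big; apply: eq_bigr => p _; rewrite -scaler_suml.
  by congr (_ *: _); elim/big_rec2: _ => // i u v _ ->.
move=> i _; rewrite {1}tP scaler_sumr.
by apply: eq_bigr => p _; rewrite scalerA.
Qed.

Lemma lip0F_eval_subproof (f : lip0F x0 (dual E)) :
  lip0_eval f \in Defs.span (@box_duals R k X x0 E).
Proof.
have [s ->] := finite_rank_sum _ (valP f); rewrite linear_sum.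
apply: rpred_sum => p _.
have := mem_span (box_dualsP (lip0_apply f p.2) p.1).
by rewrite -lip0_eval_scale.
Qed.

Definition lip0F_eval (f : lip0F x0 (dual E)) : assoc_tensor x0 E :=
  SpanType (lip0F_eval_subproof f).

Lemma lip0F_eval_is_linear : linear lip0F_eval.
Proof. by move=> a f g; apply/val_inj; exact: lip0_eval_is_linear. Qed.

HB.instance Definition _ :=
  GRing.isLinear.Build K (lip0F x0 (dual E)) (assoc_tensor x0 E) _
    lip0F_eval lip0F_eval_is_linear.

Definition lip0F_scale g phi : lip0F x0 (dual E) :=
  Lip0F (lip0_scale_finite_rank g phi).

Lemma lip0F_eval_scale g phi : lip0F_eval (lip0F_scale g phi) = assoc_box g phi.
Proof. exact/val_inj/lip0_eval_scale. Qed.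

Lemma lip0F_eval_inj : injective lip0F_eval.
Proof.
by move=> f g fg; apply/val_inj/lip0_eval_inj; exact: (congr1 val fg).
Qed.

Lemma lip0F_eval_surj h : exists f : lip0F x0 (dual E), lip0F_eval f = h.
Proof.
have [n [a [t [tb hE]]]] := asboolW (valP h).
have /choice[f fE] i : exists f : lip0F x0 (dual E), val (lip0F_eval f) = t i.
  have [g [phi ->]] := tb i.
  by exists (lip0F_scale g phi); rewrite lip0F_eval_scale.
exists (\sum_i a i *: f i); apply/val_inj; rewrite hE linear_sum raddf_sum.
by apply: eq_bigr => i _; rewrite linearZ -fE.
Qed.

End Evaluation.

Theorem theorem2p7 (R : realType) (k : scalar_kind) (X : metricType R) (x0 : X)
    (E : completeNormedModType (scalars R k)) :
  exists K : {linear assoc_tensor x0 E -> lip0F x0 (dual E)},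
    (forall (m : nat) (g : 'I_m -> lip0 x0 (scalars R k)^o) (phi : 'I_m -> dual E),
       val (K (\sum_(j < m) assoc_box (g j) (phi j))) =
         \sum_(j < m) lip0_scale (g j) (phi j))
    /\ bijective K.
Proof.
have /choice[K evalK] := @lip0F_eval_surj R k X x0 E.
have Keval : cancel (@lip0F_eval R k X x0 E) K.
  by move=> f; apply: lip0F_eval_inj; rewrite evalK.
pose KL : {linear assoc_tensor x0 E -> lip0F x0 (dual E)} :=
  HB.pack K (GRing.isLinear.Build _ _ _ _ K (can2_linear Keval evalK)).
exists KL; split; last by exists (@lip0F_eval R k X x0 E).
move=> m g phi; rewrite linear_sum raddf_sum; apply: eq_bigr => j _.
by rewrite -lip0F_eval_scale /= Keval.
Qed.
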